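(* Let $\omega(x,y,z) = [x,[y,z]]$, where $[u,v]=uv-vu$ (the Lie family, $q=\infty$). Then the universal associative envelope $U(A^\omega)$ is isomorphic, as a unital associative algebra, to the down-up algebra $A(2,-1,-2)$.
   Context: $\mathbb{F}$ is a field of characteristic $0$. $A$ is the 2-dimensional space of $2\times 2$ matrices over $\mathbb{F}$ with zero diagonal, with basis $e_1 = \begin{bmatrix} 0&1\\0&0\end{bmatrix}$, $e_2 = \begin{bmatrix} 0&0\\1&0\end{bmatrix}$; it is closed under triple products $xyz$ of matrices. For a trilinear operation $\omega(x,y,z)$ (a fixed rational linear combination of the six products of $x,y,z$ in all orders), $A^\omega$ denotes the space $A$ with the trilinear operation $\omega$ computed using matrix multiplication. Let $\mathbb{F}\langle a,b\rangle$ be the free unital associative algebra and $\phi\colon A \to \mathbb{F}\langle a,b\rangle$ the linear map with $\phi(e_1)=a$, $\phi(e_2)=b$. The universal associative envelope is $U(A^\omega) = \mathbb{F}\langle a,b\rangle / I$, where $I$ is the two-sided ideal generated by the elements $\omega(\phi(x),\phi(y),\phi(z)) - \phi(\omega(x,y,z))$ for $x,y,z\in\{e_1,e_2\}$. For $\alpha,\beta,\gamma\in\mathbb{F}$, the down-up algebra $A(\alpha,\beta,\gamma)$ is the unital associative $\mathbb{F}$-algebra with generators $a,b$ and relations $b^2a = \alpha bab + \beta ab^2 + \gamma b$ and $ba^2 = \alpha aba + \beta a^2 b + \gamma a$. *)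

(* Defs.v *)
From HB Require Import structures.
From mathcomp Require Import all_boot all_order all_algebra.
From mathcomp Require Import boolp.
From mathcomp Require Import monalg.

Set Implicit Arguments.
Unset Strict Implicit.
Unset Printing Implicit Defensive.

Import GRing.Theory.
Local Open Scope ring_scope.

Section TwoSidedIdeal.
Variables (R : nzRingType) (S : R -> Prop).

Inductive ideal_gen : R -> Prop :=
| ideal_gen_mem u : S u -> ideal_gen u
| ideal_gen0 : ideal_gen 0
| ideal_genD u v : ideal_gen u -> ideal_gen v -> ideal_gen (u + v)
| ideal_genMl r u : ideal_gen u -> ideal_gen (r * u)
| ideal_genMr r u : ideal_gen u -> ideal_gen (u * r).

Definition ideal_pred : {pred R} := fun u => `[< ideal_gen u >].

Lemma ideal_predP u : reflect (ideal_gen u) (u \in ideal_pred).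
Proof. exact: asboolP. Qed.

Lemma ideal_pred_zmod_closed : zmod_closed ideal_pred.
Proof.
split=> [|u v /ideal_predP Iu /ideal_predP Iv]; apply/ideal_predP.
  exact: ideal_gen0.
by apply: ideal_genD => //; rewrite -mulN1r; apply: ideal_genMl.
Qed.
HB.instance Definition _ :=
  GRing.isZmodClosed.Build R ideal_pred ideal_pred_zmod_closed.

Lemma ideal_predMl r u : u \in ideal_pred -> r * u \in ideal_pred.
Proof. by move=> /ideal_predP Iu; apply/ideal_predP/ideal_genMl. Qed.

Lemma ideal_predMr r u : u \in ideal_pred -> u * r \in ideal_pred.
Proof. by move=> /ideal_predP Iu; apply/ideal_predP/ideal_genMr. Qed.

End TwoSidedIdeal.

(* The quotient of B by the two-sided ideal generated by S. Nothing prevents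
   this ideal from being all of B, and the library's algType excludes the zero
   ring; so the quotient is declared both as a pzRingType and as an lmodType,
   with the compatibility of * and *: given by quot_scalerAl and
   quot_scalerAr. *)
Section QuotientAlgebra.
Variables (F : fieldType) (B : algType F) (S : B -> Prop).
Local Open Scope quotient_scope.
Local Notation I := (ideal_pred S).

Definition quot_alg := Quotient.quot I.
HB.instance Definition _ := GRing.Zmodule.on quot_alg.

Definition quot_pi (u : B) : quot_alg := \pi_(Quotient.quot I) u.
Definition quot_repr (x : quot_alg) : B := repr x.

Lemma quot_reprK : cancel quot_repr quot_pi.
Proof. by move=> x; rewrite /quot_pi /quot_repr reprK. Qed.

Lemma quot_piE u v : (quot_pi u = quot_pi v) <-> (u - v \in I).
Proof. by rewrite Quotient.idealrBE; split=> /eqP. Qed.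

Lemma quot_pi_sub u : u - quot_repr (quot_pi u) \in I.
Proof. by apply/quot_piE; rewrite quot_reprK. Qed.

Lemma quot_piB : {morph quot_pi : u v / u - v}.
Proof. by move=> u v; apply: raddfB. Qed.
HB.instance Definition _ :=
  GRing.isZmodMorphism.Build B quot_alg quot_pi quot_piB.

Definition quot_one : quot_alg := quot_pi 1.
Definition quot_mul (x y : quot_alg) : quot_alg :=
  quot_pi (quot_repr x * quot_repr y).
Definition quot_scale (k : F) (x : quot_alg) : quot_alg :=
  quot_pi (k *: quot_repr x).

Lemma quot_pi_mul u v : quot_pi (u * v) = quot_mul (quot_pi u) (quot_pi v).
Proof.
apply/quot_piE; set u' := quot_repr _; set v' := quot_repr _.
have -> : u * v - u' * v' = (u - u') * v + u' * (v - v').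
  by rewrite mulrBl mulrBr addrA subrK.
apply: rpredD; first exact/ideal_predMr/quot_pi_sub.
exact/ideal_predMl/quot_pi_sub.
Qed.

Lemma quot_pi_scale k u : quot_pi (k *: u) = quot_scale k (quot_pi u).
Proof.
apply/quot_piE; rewrite -scalerBr -[X in k *: X]mul1r scalerAl.
exact/ideal_predMl/quot_pi_sub.
Qed.

Lemma quot_mulA : associative quot_mul.
Proof.
move=> x y z; rewrite -[x]quot_reprK -[y]quot_reprK -[z]quot_reprK.
by rewrite -!quot_pi_mul mulrA.
Qed.
Lemma quot_mul1 : left_id quot_one quot_mul.
Proof. by move=> x; rewrite -[x]quot_reprK -quot_pi_mul mul1r. Qed.
Lemma quot_mulr1 : right_id quot_one quot_mul.
Proof. by move=> x; rewrite -[x]quot_reprK -quot_pi_mul mulr1. Qed.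
Lemma quot_mulDl : left_distributive quot_mul +%R.
Proof.
move=> x y z; rewrite -[x]quot_reprK -[y]quot_reprK -[z]quot_reprK.
by rewrite -raddfD -!quot_pi_mul mulrDl raddfD.
Qed.
Lemma quot_mulDr : right_distributive quot_mul +%R.
Proof.
move=> x y z; rewrite -[x]quot_reprK -[y]quot_reprK -[z]quot_reprK.
by rewrite -raddfD -!quot_pi_mul mulrDr raddfD.
Qed.
HB.instance Definition _ := GRing.Zmodule_isPzRing.Build quot_alg
  quot_mulA quot_mul1 quot_mulr1 quot_mulDl quot_mulDr.

Lemma quot_scaleA k l x : quot_scale k (quot_scale l x) = quot_scale (k * l) x.
Proof. by rewrite -[x]quot_reprK -!quot_pi_scale scalerA. Qed.
Lemma quot_scale1 : left_id 1 quot_scale.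
Proof. by move=> x; rewrite -[x]quot_reprK -quot_pi_scale scale1r. Qed.
Lemma quot_scaleDr : right_distributive quot_scale +%R.
Proof.
move=> k x y; rewrite -[x]quot_reprK -[y]quot_reprK.
by rewrite -raddfD -!quot_pi_scale scalerDr raddfD.
Qed.
Lemma quot_scaleDl x : {morph quot_scale^~ x : k l / k + l}.
Proof.
move=> k l; rewrite -[x]quot_reprK -!quot_pi_scale.
by rewrite scalerDl raddfD.
Qed.
HB.instance Definition _ := GRing.Zmodule_isLmodule.Build F quot_alg
  quot_scaleA quot_scale1 quot_scaleDr quot_scaleDl.

Lemma quot_pi_monoid_morphism : monoid_morphism quot_pi.
Proof. by split=> // u v; apply: quot_pi_mul. Qed.
HB.instance Definition _ :=
  GRing.isMonoidMorphism.Build B quot_alg quot_pi quot_pi_monoid_morphism.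

Lemma quot_pi_scalable : scalable quot_pi.
Proof. exact: quot_pi_scale. Qed.
HB.instance Definition _ :=
  GRing.isScalable.Build F B quot_alg *:%R quot_pi quot_pi_scalable.

Lemma quot_scalerAl k (x y : quot_alg) : k *: (x * y) = k *: x * y.
Proof.
rewrite -[x]quot_reprK -[y]quot_reprK.
by rewrite -rmorphM -!linearZ -rmorphM scalerAl.
Qed.
Lemma quot_scalerAr k (x y : quot_alg) : k *: (x * y) = x * (k *: y).
Proof.
rewrite -[x]quot_reprK -[y]quot_reprK.
by rewrite -rmorphM -!linearZ -rmorphM scalerAr.
Qed.

End QuotientAlgebra.

Lemma malg_scalerAr (K : monomType) (F : fieldType) (k : F)
    (u v : {malg F[K]}) :
  k *: (u * v) = u * (k *: v).
Proof.
have comm_k : k%:MP * u = u * k%:MP.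
  change (fgmul k%:MP u = fgmul u k%:MP); rewrite /malgC fgmulUg fgmulgU.
  by apply: eq_bigr => m _; rewrite mul1m mulm1 mulrC.
by rewrite -(mul_malgC k (u * v)) -(mul_malgC k v) mulrA comm_k mulrA.
Qed.

(* The free unital associative algebra F<a,b>: the monoid algebra over F of
   the free monoid on two letters. *)
Definition free_alg2 (F : fieldType) : Type := {malg F[{fmonom 'I_2}]}.

Section FreeAlgebra.
Variable F : fieldType.

HB.instance Definition _ := GRing.Lalgebra.on (free_alg2 F).
HB.instance Definition _ :=
  GRing.Lalgebra_isAlgebra.Build F (free_alg2 F) (@malg_scalerAr _ F).

Definition gen_a : free_alg2 F := mkmalgU (fmu (ord0 : 'I_2)) 1.
Definition gen_b : free_alg2 F := mkmalgU (fmu (ord_max : 'I_2)) 1.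

End FreeAlgebra.

Definition commutator (R : pzRingType) (u v : R) : R := u * v - v * u.

(* A trilinear operation: a rational linear combination of the six products
   of x, y, z in all orders. *)
Record trilinear_op : Type := TrilinearOp {
  coef_xyz : rat; coef_xzy : rat; coef_yxz : rat;
  coef_yzx : rat; coef_zxy : rat; coef_zyx : rat }.

Section TrilinearOperation.
Variables (F : fieldType) (w : trilinear_op).

Definition trilinear_eval (R : algType F) (x y z : R) : R :=
    ratr (coef_xyz w) *: (x * y * z) + ratr (coef_xzy w) *: (x * z * y)
  + ratr (coef_yxz w) *: (y * x * z) + ratr (coef_yzx w) *: (y * z * x)
  + ratr (coef_zxy w) *: (z * x * y) + ratr (coef_zyx w) *: (z * y * x).

End TrilinearOperation.

(* The operation [x,[y,z]] is indeed one of these. *)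
Lemma lie_trilinear_op_exists (F : fieldType) :
  exists w : trilinear_op, forall (R : algType F) (x y z : R),
    trilinear_eval w x y z = commutator x (commutator y z).
Proof.
have ratr1 : ratr 1 = 1 :> F by rewrite [LHS](ratr_int _ 1).
have ratr0 : ratr 0 = 0 :> F by rewrite [LHS](ratr_int _ 0).
have ratrN1 : ratr (- 1) = - 1 :> F by rewrite [LHS](ratr_int _ (- 1)).
exists (TrilinearOp 1%R (- 1)%R 0%R (- 1)%R 0%R 1%R) => R x y z.
rewrite /trilinear_eval /commutator [coef_xyz _]/= [coef_xzy _]/= [coef_yxz _]/=.
rewrite [coef_yzx _]/= [coef_zxy _]/= [coef_zyx _]/= ratr1 ratr0 ratrN1.
rewrite !scaleN1r !scale1r !scale0r !addr0 mulrBr mulrBl opprB !mulrA.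
by rewrite [in RHS]addrA [RHS]addrAC.
Qed.

Definition zero_diag (F : fieldType) : {pred 'M[F]_2} :=
  fun M => [forall i, M i i == 0].

Section ZeroDiagonal.
Variable F : fieldType.

Lemma zero_diagP (M : 'M[F]_2) :
  reflect (forall i, M i i = 0) (M \in @zero_diag F).
Proof. exact: 'forall_eqP. Qed.

Lemma zero_diag_submod_closed : submod_closed (@zero_diag F).
Proof.
split=> [|k M N /zero_diagP M0 /zero_diagP N0]; apply/zero_diagP => i.
  by rewrite mxE.
by rewrite !mxE M0 N0 mulr0 addr0.
Qed.
HB.instance Definition _ :=
  GRing.isSubmodClosed.Build F 'M[F]_2 (@zero_diag F) zero_diag_submod_closed.

Lemma zero_diagM3 (x y z : 'M[F]_2) :
  x \in @zero_diag F -> y \in @zero_diag F -> z \in @zero_diag F ->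
  x * y * z \in @zero_diag F.
Proof.
move=> /zero_diagP x0 /zero_diagP y0 /zero_diagP z0; apply/zero_diagP => i.
rewrite mxE big1 // => j _; case: (eqVneq j i) => [->|ne_ji].
  by rewrite z0 mulr0.
rewrite mxE big1 ?mul0r // => k _; case: (eqVneq k i) => [->|ne_ki].
  by rewrite x0 mul0r.
suff -> : k = j by rewrite y0 mulr0.
by move: i j k ne_ji ne_ki => [[|[|//]] ?] [[|[|//]] ?] [[|[|//]] ?] //= _ _;
  apply: val_inj.
Qed.

End ZeroDiagonal.

Record offdiag (F : fieldType) : Type :=
  Offdiag { offdiag_mx :> 'M[F]_2; offdiagP : offdiag_mx \in @zero_diag F }.
HB.instance Definition _ (F : fieldType) := [isSub for @offdiag_mx F].
HB.instance Definition _ (F : fieldType) := [Choice of offdiag F by <:].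
HB.instance Definition _ (F : fieldType) :=
  [SubChoice_isSubLmodule of offdiag F by <:].

Section ZeroDiagonalTriple.
Variables (F : fieldType) (w : trilinear_op).

Lemma zero_diag_trilinear_eval (x y z : offdiag F) :
  trilinear_eval w (x : 'M[F]_2) (y : 'M[F]_2) (z : 'M[F]_2)
    \in @zero_diag F.
Proof.
by rewrite /trilinear_eval !rpredD // rpredZ // zero_diagM3 // offdiagP.
Qed.

Definition offdiag_op (x y z : offdiag F) : offdiag F :=
  Offdiag (zero_diag_trilinear_eval x y z).

Lemma zero_diag_delta (i j : 'I_2) :
  i != j -> (delta_mx i j : 'M[F]_2) \in @zero_diag F.
Proof.
move=> neq_ij; apply/zero_diagP => k; rewrite mxE.
by case: eqP => // ->; rewrite (negbTE neq_ij).
Qed.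

Definition offdiag_e1 : offdiag F :=
  Offdiag (@zero_diag_delta ord0 ord_max isT).
Definition offdiag_e2 : offdiag F :=
  Offdiag (@zero_diag_delta ord_max ord0 isT).

End ZeroDiagonalTriple.

(* The linear map sending e_1 to a and e_2 to b, and the generators of the
   ideal defining the envelope, for a and b in any algebra B. *)
Section EnvelopeRelations.
Variables (F : fieldType) (w : trilinear_op) (B : algType F) (a b : B).

Definition offdiag_phi (x : offdiag F) : B :=
  offdiag_mx x ord0 ord_max *: a + offdiag_mx x ord_max ord0 *: b.

Lemma offdiag_phi_linear : linear offdiag_phi.
Proof.
move=> k x y; rewrite /offdiag_phi.
have entryE i j :
    offdiag_mx (k *: x + y) i j = k * offdiag_mx x i j + offdiag_mx y i j.
  by rewrite /= !mxE.
by rewrite !entryE !scalerDl scalerDr !scalerA addrACA.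
Qed.
HB.instance Definition _ :=
  GRing.isLinear.Build F (offdiag F) B *:%R offdiag_phi offdiag_phi_linear.

Lemma offdiag_phi_e1 : offdiag_phi (offdiag_e1 F) = a.
Proof. by rewrite /offdiag_phi !mxE /= scale1r scale0r addr0. Qed.
Lemma offdiag_phi_e2 : offdiag_phi (offdiag_e2 F) = b.
Proof. by rewrite /offdiag_phi !mxE /= scale1r scale0r add0r. Qed.

Definition envelope_rel (u : B) : Prop :=
  exists x y z : offdiag F,
    [/\ x \in [:: offdiag_e1 F; offdiag_e2 F],
        y \in [:: offdiag_e1 F; offdiag_e2 F],
        z \in [:: offdiag_e1 F; offdiag_e2 F]
      & u = trilinear_eval w (offdiag_phi x) (offdiag_phi y) (offdiag_phi z)
            - offdiag_phi (offdiag_op w x y z)].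

End EnvelopeRelations.

Definition universal_envelope (F : fieldType) (w : trilinear_op) : Type :=
  quot_alg (envelope_rel w (gen_a F) (gen_b F)).
HB.instance Definition _ (F : fieldType) (w : trilinear_op) :=
  GRing.PzRing.on (universal_envelope F w).
HB.instance Definition _ (F : fieldType) (w : trilinear_op) :=
  GRing.Lmodule.on (universal_envelope F w).

Section DownUpRelations.
Variables (F : fieldType) (alpha beta gamma : F) (B : algType F) (a b : B).

Definition down_up_rel (u : B) : Prop :=
  u = b ^+ 2 * a
      - (alpha *: (b * a * b) + beta *: (a * b ^+ 2) + gamma *: b)
  \/ u = b * a ^+ 2
      - (alpha *: (a * b * a) + beta *: (a ^+ 2 * b) + gamma *: a).

End DownUpRelations.

Definition down_up (F : fieldType) (alpha beta gamma : F) : Type :=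
  quot_alg (down_up_rel alpha beta gamma (gen_a F) (gen_b F)).
HB.instance Definition _ (F : fieldType) (alpha beta gamma : F) :=
  GRing.PzRing.on (down_up alpha beta gamma).
HB.instance Definition _ (F : fieldType) (alpha beta gamma : F) :=
  GRing.Lmodule.on (down_up alpha beta gamma).

(* Main.v *)
(* On the zero-diagonal matrices, with coordinates x = x1 e1 + x2 e2,
   [x, [y, z]] = (y1 z2 - y2 z1) [x, [e1, e2]], [e1, [e1, e2]] = - 2 e1 and
   [e2, [e1, e2]] = 2 e2. As the same bilinear expansion holds in F<a,b>, the
   relations of the envelope are spanned by [a, [a, b]] + 2 a and
   [b, [a, b]] - 2 b, which up to sign are the two down-up relations: both
   algebras are quotients of F<a,b> by the same ideal. *)
Require Import Defs.
From mathcomp Require Import all_boot all_order all_algebra.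
From mathcomp Require Import boolp monalg ring.
Import GRing.Theory.
Local Open Scope ring_scope.

Lemma ideal_gen_sub (R : nzRingType) (S T : R -> Prop) :
  (forall u, S u -> ideal_gen T u) -> forall u, ideal_gen S u -> ideal_gen T u.
Proof.
move=> sST u; elim=> {u} [u /sST // | | u v _ Tu _ Tv | r u _ Tu | r u _ Tu].
- exact: ideal_gen0.
- exact: ideal_genD.
- exact: ideal_genMl.
- exact: ideal_genMr.
Qed.

Lemma ideal_genZ (F : fieldType) (B : algType F) (S : B -> Prop) (k : F) u :
  ideal_gen S u -> ideal_gen S (k *: u).
Proof. by rewrite -[u in k *: u]mul1r scalerAl; apply: ideal_genMl. Qed.

(** Mutual containment of the generators makes the two ideals equal. The isomorphism projects a
    representative to the other quotient, and its inverse is the same construction with [S] and [T]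
    exchanged. *)
Lemma quot_alg_iso (F : fieldType) (B : algType F) (S T : B -> Prop) :
  (forall u, S u -> ideal_gen T u) -> (forall u, T u -> ideal_gen S u) ->
  exists f : quot_alg S -> quot_alg T,
    [/\ linear f, monoid_morphism f & bijective f].
Proof.
move=> sST sTS.
(* The chosen representative differs from [u] by an element of the ideal of [S1], which the quotient
   by [T1] also kills. *)
have lift_pi (S1 T1 : B -> Prop) : (forall u, S1 u -> ideal_gen T1 u) ->
    forall u, quot_pi T1 (quot_repr (quot_pi S1 u)) = quot_pi T1 u.
  move=> sub1 u; apply/esym/quot_piE/ideal_predP/(ideal_gen_sub _ S1 T1 sub1).
  exact/ideal_predP/quot_pi_sub.
pose f (x : quot_alg S) : quot_alg T := quot_pi T (quot_repr x).
have f_pi u : f (quot_pi S u) = quot_pi T u by exact: lift_pi.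
exists f; split.
- move=> k x y; rewrite -[x]quot_reprK -[y]quot_reprK -linearP !f_pi.
  by rewrite linearP.
- split=> [|x y]; first exact: f_pi.
  by rewrite -[x]quot_reprK -[y]quot_reprK -rmorphM !f_pi rmorphM.
- exists (fun y => quot_pi S (quot_repr y)) => [x|y].
    by rewrite -[x]quot_reprK f_pi lift_pi.
  by rewrite -[y]quot_reprK lift_pi // f_pi.
Qed.

Section Commutator.
Variables (F : fieldType) (B : algType F).
Implicit Types (k : F) (u v w : B).

Lemma commutatorC u v : commutator u v = - commutator v u.
Proof. by rewrite /commutator opprB. Qed.

Lemma commutatorxx u : commutator u u = 0.
Proof. exact: subrr. Qed.

Lemma commutatorDl u v w : commutator (u + v) w = commutator u w + commutator v w.
Proof. by rewrite /commutator mulrDl mulrDr opprD addrACA. Qed.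

Lemma commutatorDr u v w : commutator u (v + w) = commutator u v + commutator u w.
Proof. by rewrite /commutator mulrDl mulrDr opprD addrACA. Qed.

Lemma commutatorZl k u v : commutator (k *: u) v = k *: commutator u v.
Proof. by rewrite /commutator -scalerAl -scalerAr scalerBr. Qed.

Lemma commutatorZr k u v : commutator u (k *: v) = k *: commutator u v.
Proof. by rewrite /commutator -scalerAl -scalerAr scalerBr. Qed.

Lemma commutator_lincomb u v (y1 y2 z1 z2 : F) :
  commutator (y1 *: u + y2 *: v) (z1 *: u + z2 *: v)
    = (y1 * z2 - y2 * z1) *: commutator u v.
Proof.
rewrite commutatorDl !commutatorDr !commutatorZl !commutatorZr !commutatorxx.
rewrite !scaler0 add0r addr0 [commutator v u]commutatorC !scalerN !scalerA.
by rewrite scalerBl.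
Qed.

Lemma double_commutatorE u v :
  commutator u (commutator u v) = u ^+ 2 * v - u * v * u - u * v * u + v * u ^+ 2.
Proof.
rewrite /commutator mulrBr mulrBl !expr2 !mulrA opprB.
by rewrite !addrA addrAC.
Qed.

End Commutator.

(** Here [w_lie] is applied to matrices: [y, z] is a multiple of diag(1, -1), and bracketing with
    diag(1, -1) on the right scales e1 by -2 and e2 by 2. *)
Lemma offdiag_phi_lie (F : fieldType) (w : trilinear_op)
    (w_lie : forall (R : algType F) (x y z : R),
       trilinear_eval w x y z = commutator x (commutator y z))
    (B : algType F) (a b : B) (x y z : offdiag F) :
  offdiag_phi a b (offdiag_op w x y z)
    = (y ord0 ord_max * z ord_max ord0 - y ord_max ord0 * z ord0 ord_max)
      *: (x ord_max ord0 *: (2 *: b) - x ord0 ord_max *: (2 *: a)).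
Proof.
have /zero_diagP x0 := offdiagP x; have /zero_diagP y0 := offdiagP y.
have /zero_diagP z0 := offdiagP z.
rewrite /offdiag_phi /= w_lie /commutator !mxE !big_ord_recl !big_ord0 !mxE.
rewrite !big_ord_recl !big_ord0.
have -> : lift ord0 ord0 = ord_max :> 'I_2 by exact: val_inj.
rewrite !x0 !y0 !z0 !scalerBr !scalerA [LHS]addrC -scaleNr.
by congr (_ *: _ + _ *: _); ring.
Qed.

Lemma down_up_relE (F : fieldType) (B : algType F) (a b u : B) :
  down_up_rel (2 : F) (-1) (-2) a b u <->
  u = commutator b (commutator b a) + 2 *: b \/
  u = commutator a (commutator a b) + 2 *: a.
Proof.
rewrite /down_up_rel !double_commutatorE !scaleNr !scale1r !opprD !opprK !addrA.
rewrite !scaler_nat !mulr2n !opprD !addrA.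
(* The second relation begins with b a^2, the expansion of [a, [a, b]] with a^2 b; only the outer
   terms need exchanging. *)
have swap (x y p : B) : x - p - p + y = y - p - p + x.
  by rewrite -(addrA x) -(addrA y) [LHS]addrC addrA addrAC.
by rewrite (swap (b * a ^+ 2)).
Qed.

(** The bracket in [B] and the bracket of matrices yield the same factor y1 z2 - y2 z1, which comes
    out. The inner minus sign comes from [b, [a, b]] = - [b, [b, a]]. *)
Lemma envelope_relE (F : fieldType) (w : trilinear_op)
    (w_lie : forall (R : algType F) (x y z : R),
       trilinear_eval w x y z = commutator x (commutator y z))
    (B : algType F) (a b : B) (x y z : offdiag F) :
  trilinear_eval w (offdiag_phi a b x) (offdiag_phi a b y) (offdiag_phi a b z)
      - offdiag_phi a b (offdiag_op w x y z)
    = (y ord0 ord_max * z ord_max ord0 - y ord_max ord0 * z ord0 ord_max)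
      *: (x ord0 ord_max *: (commutator a (commutator a b) + 2 *: a)
          - x ord_max ord0 *: (commutator b (commutator b a) + 2 *: b)).
Proof.
rewrite w_lie offdiag_phi_lie // {2 3}/offdiag_phi commutator_lincomb.
rewrite commutatorZr -scalerBr; congr (_ *: _).
rewrite /offdiag_phi commutatorDl !commutatorZl [commutator b a]commutatorC.
rewrite -[- commutator a b]scaleN1r commutatorZr scaleN1r.
rewrite !scalerDr !scalerN !opprD !opprK.
rewrite [- _ + _ in LHS]addrC addrACA.
by rewrite -(scalerBr _ (b * _)).
Qed.

Theorem lemma4p17 (F : fieldType) (charF0 : [pchar F] =i pred0)
    (w : trilinear_op)
    (w_lie : forall (R : algType F) (x y z : R),
       trilinear_eval w x y z = commutator x (commutator y z)) :
  exists f : universal_envelope F w -> down_up (2 : F) (-1) (-2),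
    [/\ linear f, monoid_morphism f & bijective f].
Proof.
apply: quot_alg_iso => u.
  move=> [x [y [z [_ _ _ ->]]]]; rewrite envelope_relE //.
  apply/ideal_genZ/ideal_genD; last rewrite -scaleNr.
    by apply/ideal_genZ/ideal_gen_mem/down_up_relE; right.
  by apply/ideal_genZ/ideal_gen_mem/down_up_relE; left.
(* For the converse, each down-up relation is itself an envelope relation at a suitable triple of
   basis vectors. *)
have rel x y z : x \in [:: offdiag_e1 F; offdiag_e2 F] ->
    y \in [:: offdiag_e1 F; offdiag_e2 F] ->
    z \in [:: offdiag_e1 F; offdiag_e2 F] ->
    envelope_rel w (gen_a F) (gen_b F) ((y ord0 ord_max * z ord_max ord0
        - y ord_max ord0 * z ord0 ord_max)
      *: (x ord0 ord_max *: (commutator (gen_a F) (commutator (gen_a F) (gen_b F))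
            + 2 *: gen_a F)
          - x ord_max ord0 *: (commutator (gen_b F) (commutator (gen_b F) (gen_a F))
            + 2 *: gen_b F))).
  by move=> *; exists x, y, z; split=> //; rewrite envelope_relE.
have e1 : offdiag_e1 F \in [:: offdiag_e1 F; offdiag_e2 F] by rewrite !inE eqxx.
have e2 : offdiag_e2 F \in [:: offdiag_e1 F; offdiag_e2 F] by rewrite !inE eqxx orbT.
case/down_up_relE => ->; apply: ideal_gen_mem.
  (* At (e2, e2, e1) the outer factor is -1 and cancels the inner minus sign. *)
  have := rel _ _ _ e2 e2 e1; rewrite !mxE /= mul0r mul1r scale0r !scale1r.
  by rewrite !sub0r scaleN1r opprK.
(* At (e1, e1, e2) the outer factor is 1 and only the term in x1 survives. *)
have := rel _ _ _ e1 e1 e2; rewrite !mxE /= mul0r mul1r scale0r !subr0.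
by rewrite !scale1r.
Qed.
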